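(* Let $m,n$ be even positive integers, $N=mn$, $d,t\ge 1$, let $x_k=(x_k^1,\dots,x_k^d)$ with $x_k^l\in\mathbb{R}^{m\times n}$ ($1\le k\le t$, $1\le l\le d$) be training samples, $\alpha_1,\dots,\alpha_t\ge 0$ and $\lambda\ge 0$ real numbers, and $y\in\mathbb{R}^{m\times n}$. Consider the correlation filter problem $$\min_{f=(f^1,\dots,f^d)}\ \sum_{k=1}^{t}\alpha_k\Big\|\sum_{l=1}^{d}x_k^l\circledcirc f^l-y\Big\|^2+\lambda\sum_{l=1}^{d}\|f^l\|^2 \qquad (\mathrm{Corr})$$ and the convolution filter problem $$\min_{f=(f^1,\dots,f^d)}\ \sum_{k=1}^{t}\alpha_k\Big\|\sum_{l=1}^{d}x_k^l\circledast f^l-y\Big\|^2+\lambda\sum_{l=1}^{d}\|f^l\|^2 \qquad (\mathrm{Conv})$$ over $f^l\in\mathbb{R}^{m\times n}$. Let $\hat{\mathbf f}_*$ and $\hat{\mathbf f}'_*$ denote the optimal solutions (in the Fourier domain, as defined in the context) of $(\mathrm{Corr})$ and $(\mathrm{Conv})$ respectively. Then: (1) $\hat{\mathbf f}_*$ exists if and only if $\hat{\mathbf f}'_*$ exists. (2) Suppose moreover that these optimal solutions exist and that $y$ is a 2-D centrosymmetric Gaussian function. Then $$\hat{\mathbf f}_*=\overline{\hat{\mathbf f}'_*}\quad\text{(entrywise complex conjugate)}.$$ Furthermore, let $f_*=(f_*^1,\dots,f_*^d)$ and $f'_*=(f_*'^1,\dots,f_*'^d)$ be the spatial-domain filters corresponding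 to $\hat{\mathbf f}_*$ and $\hat{\mathbf f}'_*$. Then for every detection sample $x_{k'}=(x_{k'}^1,\dots,x_{k'}^d)$ with $x_{k'}^l\in\mathbb{R}^{m\times n}$, the filter responses $$R(x_{k'};f_* )=\sum_{l=1}^d x_{k'}^l\circledcirc f_*^l,\qquad R'(x_{k'};f'_* )=\sum_{l=1}^d x_{k'}^l\circledast f_*'^l$$ satisfy $$\|R(x_{k'};f_* )-y\|^2=\|R'(x_{k'};f'_* )-y\|^2$$ and $$R(x_{k'};f_* )[i,j]=R'(x_{k'};f'_* )[-i,-j]\quad\text{for all integers } i\in[-\tfrac m2,\tfrac m2],\ j\in[-\tfrac n2,\tfrac n2].$$
   Context: Indexing: entries $z[i,j]$ of an $m\times n$ array are indexed by integers $i$ modulo $m$ and $j$ modulo $n$ (periodic indexing). $\|z\|=\big(\sum_{i \bmod m}\sum_{j \bmod n}|z[i,j]|^2\big)^{1/2}$ is the Frobenius norm. Circular convolution and circular correlation: $(x\circledast f)[i,j]=\sum_{p \bmod m}\sum_{q \bmod n}x[p,q]\,f[i-p,j-q]$ and $(x\circledcirc f)[i,j]=\sum_{p \bmod m}\sum_{q \bmod n}\overline{x[p,q]}\,f[p+i,q+j]$. Fourier transform: $\hat z=\mathrm{F}\{z\}$ is the 2-D discrete Fourier transform $\hat z[u,v]=\sum_{i,j}z[i,j]e^{-2\pi \mathrm{i}(ui/m+vj/n)}$, and $\mathrm{F}^{-1}$ is its inverse. With $\odot$ the entrywise product, $\widehat{x\circledast f}=\hat x\odot\hat f$ and $\widehat{x\circledcirc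 f}=\overline{\hat x}\odot\hat f$. Vectorization: $\vec z\in\mathbb{C}^{N}$ denotes the vectorization of an $m\times n$ array $z$ (in a fixed order), $\mathrm{vec}^{-1}$ is the inverse operation, $\mathrm{H}$ denotes conjugate transpose, and $\mathrm{I}_{dN}$ is the $dN\times dN$ identity matrix. Put $\hat{\mathbf y}=\vec{\hat y}$ and $$\hat{\mathbf X}_k=[\mathrm{diag}(\vec{\hat x}_k^1)^{\mathrm H},\dots,\mathrm{diag}(\vec{\hat x}_k^d)^{\mathrm H}],\qquad \hat{\mathbf X}'_k=[\mathrm{diag}(\vec{\hat x}_k^1),\dots,\mathrm{diag}(\vec{\hat x}_k^d)],$$ which are $N\times dN$ matrices. A filter $f=(f^1,\dots,f^d)$ is represented in the Fourier domain by the column vector in $\mathbb{C}^{dN}$ obtained by stacking $\vec{\hat f}^1,\dots,\vec{\hat f}^d$. Optimal solutions: in the Fourier domain, $(\mathrm{Corr})$ is the linear least-squares problem $\min_{\hat{\mathbf f}}\sum_k\alpha_k\|\hat{\mathbf X}_k\hat{\mathbf f}-\hat{\mathbf y}\|^2+\lambda\|\hat{\mathbf f}\|^2$, and $(\mathrm{Conv})$ is the same with $\hat{\mathbf X}'_k$ in place of $\hat{\mathbf X}_k$. ''The optimal solution $\hat{\mathbf f}_*$ of $(\mathrm{Corr})$ exists'' means that the matrix $\sum_{k=1}^t\alpha_k\hat{\mathbf X}_k^{\mathrm H}\hat{\mathbf X}_k+\lambda \mathrm{I}_{dN}$ is invertible, and then $$\hat{\mathbf f}_*=\Big[\sum_{k=1}^t\alpha_k\hat{\mathbf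 X}_k^{\mathrm H}\hat{\mathbf X}_k+\lambda \mathrm{I}_{dN}\Big]^{-1}\sum_{k=1}^t\alpha_k\hat{\mathbf X}_k^{\mathrm H}\hat{\mathbf y}.$$ Likewise ''the optimal solution $\hat{\mathbf f}'_*$ of $(\mathrm{Conv})$ exists'' means that $\sum_{k=1}^t\alpha_k\hat{\mathbf X}_k'^{\mathrm H}\hat{\mathbf X}'_k+\lambda \mathrm{I}_{dN}$ is invertible, and then $$\hat{\mathbf f}'_*=\Big[\sum_{k=1}^t\alpha_k\hat{\mathbf X}_k'^{\mathrm H}\hat{\mathbf X}'_k+\lambda \mathrm{I}_{dN}\Big]^{-1}\sum_{k=1}^t\alpha_k\hat{\mathbf X}_k'^{\mathrm H}\hat{\mathbf y}.$$ The corresponding spatial-domain filters are obtained by cutting the vector in $\mathbb{C}^{dN}$ into $d$ consecutive blocks of length $N$ and applying $\mathrm{F}^{-1}\circ\mathrm{vec}^{-1}$ to each block: $f_*^l=\mathrm{F}^{-1}\{\mathrm{vec}^{-1}[l\text{-th block of }\hat{\mathbf f}_*]\}$, and similarly for $f_*'^l$. Centrosymmetric Gaussian: $y$ is a 2-D centrosymmetric Gaussian function if $y[i,j]=A\,e^{-Q(i,j)}$ for $-\frac m2\le i<\frac m2$, $-\frac n2\le j<\frac n2$, with $A>0$ and $Q$ a positive definite quadratic form on $\mathbb{R}^2$, and $y[i,j]=y[-i,-j]$ for all $i$ mod $m$, $j$ mod $n$. *)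

(* Defs.v *)
From HB Require Import structures.
From mathcomp Require Import all_boot all_order all_algebra.
From mathcomp Require Import complex reals sequences trigo.
From mathcomp Require Import ring lra.

Set Implicit Arguments.
Unset Strict Implicit.
Unset Printing Implicit Defensive.

Import Order.TTheory GRing.Theory Num.Theory.
Local Open Scope complex_scope.
Local Open Scope ring_scope.
Local Open Scope sesquilinear_scope.

(* Periodic indexing: the entry z[i, j] for integers i (mod m) and j (mod n).
   The default value 0 only occurs when m = 0 or n = 0. *)
Definition entry (V : nmodType) (m n : nat) (z : 'M[V]_(m, n)) (i j : int) : V :=
  match (insub `|(i %% m)%Z|%N : option 'I_m),
        (insub `|(j %% n)%Z|%N : option 'I_n) with
  | Some p, Some q => z p q
  | _, _ => 0
  end.

Lemma entry_ord (V : nmodType) (m n : nat) (z : 'M[V]_(m, n))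
    (i : 'I_m) (j : 'I_n) : entry z i%:Z j%:Z = z i j.
Proof.
rewrite /entry !modz_nat !absz_nat !modn_small ?ltn_ord//.
by rewrite !insubT //= => hi hj; congr (z _ _); apply: val_inj.
Qed.

Lemma entry_modz (V : nmodType) (m n : nat) (z : 'M[V]_(m, n)) (i j a b : int) :
  entry z (i + a * m%:Z) (j + b * n%:Z) = entry z i j.
Proof. by rewrite /entry ![_ + _ * _]addrC !modzMDl. Qed.

Section Arrays.
Variables (R : realType) (m n : nat).
Local Notation C := R[i].
Implicit Types (z x f : 'M[C]_(m, n)).

Definition toC (z : 'M[R]_(m, n)) : 'M[C]_(m, n) := map_mx (fun a : R => a%:C) z.

Definition frobenius z : R :=
  Num.sqrt (\sum_(i < m) \sum_(j < n) ComplexField.Normc.normc (z i j) ^+ 2).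

Definition circ_conv x f : 'M[C]_(m, n) :=
  \matrix_(i < m, j < n) \sum_(p < m) \sum_(q < n)
    x p q * entry f (i%:Z - p%:Z) (j%:Z - q%:Z).

Definition circ_corr x f : 'M[C]_(m, n) :=
  \matrix_(i < m, j < n) \sum_(p < m) \sum_(q < n)
    (x p q)^* * entry f (p%:Z + i%:Z) (q%:Z + j%:Z).

Definition expi (theta : R) : C := cos theta +i* sin theta.

Lemma expiD a b : expi (a + b) = expi a * expi b.
Proof. by rewrite /expi cosD sinD; simpc; rewrite [_ * sin b + _]addrC. Qed.

Lemma expi0 : expi 0 = 1.
Proof. by rewrite /expi cos0 sin0. Qed.

Lemma expi_nat a k : expi (a * k%:R) = expi a ^+ k.
Proof.
elim: k => [|k IH]; first by rewrite mulr0 expi0.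
by rewrite -natr1 mulrDr mulr1 expiD IH exprSr.
Qed.

Lemma expi_2piz (k : int) : expi (2 * pi * k%:~R) = 1.
Proof.
have e1 : expi (2 * pi) = 1 by rewrite mulr_natl /expi cos2pi sin2pi.
case: k => k; first by rewrite expi_nat e1 expr1n.
rewrite NegzE mulrNz mulrN; have := expiD (2 * pi * k.+1%:R) (- (2 * pi * k.+1%:R)).
by rewrite subrr expi0 expi_nat e1 expr1n mul1r.
Qed.

Lemma expi_neq1 a : - pi < a < pi -> a != 0 -> expi (2 * a) != 1.
Proof.
move=> /andP[alo ahi] a0; apply/negP => /eqP[c1 _]; move: c1.
have -> : 2 * a = a + a by ring.
rewrite cosD -!expr2; have := cos2Dsin2 a => h1 h2.
have /eqP : sin a ^+ 2 = 0 by lra.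
rewrite sqrf_eq0 => /eqP sa0.
have [a_gt0|a_lt0|a_eq0] := ltgtP 0 a; last by rewrite -a_eq0 eqxx in a0.
- by have := @sin_gt0_pi R a; rewrite a_gt0 ahi sa0 ltxx => /(_ isT).
- by have := @sin_gt0_pi R (- a); rewrite oppr_gt0 a_lt0 ltrNl alo sinN sa0
    oppr0 ltxx => /(_ isT).
Qed.

Lemma sum_expi (p : nat) (i j : 'I_p) :
  \sum_(u < p) expi (2 * pi * (u%:R * i%:R / p%:R - u%:R * j%:R / p%:R))
  = ((i == j) * p)%:R.
Proof.
have p_gt0 : (0 < p)%N by case: p i {j} => [[]|].
have pR_gt0 : 0 < p%:R :> R by rewrite ltr0n.
have [->|ij] := eqVneq i j.
  under eq_bigr do rewrite subrr mulr0 expi0.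
  by rewrite sumr_const card_ord mul1n.
rewrite mul0n; pose a : R := pi * ((i%:R - j%:R) / p%:R).
have ea (u : 'I_p) : expi (2 * pi * (u%:R * i%:R / p%:R - u%:R * j%:R / p%:R))
    = expi (2 * a) ^+ u.
  by rewrite -expi_nat; congr expi; rewrite /a; field; rewrite gt_eqF.
under eq_bigr do rewrite ea.
have a1 : expi (2 * a) != 1.
  apply: expi_neq1.
    have q1 : `|(i%:R - j%:R) / p%:R| < 1 :> R.
      rewrite normrM normfV (gtr0_norm pR_gt0) ltr_pdivrMr // mul1r ltr_norml.
      have := ltn_ord i; have := ltn_ord j; rewrite -2!(ltr_nat R).
      have := ler0n R i; have := ler0n R j; lra.
    have p0 : 0 < pi :> R := pi_gt0 R.
    have: `|a| < pi by rewrite normrM (gtr0_norm p0) gtr_pMr.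
    by rewrite ltr_norml.
  rewrite !mulf_neq0 ?invr_eq0 ?(gt_eqF pR_gt0) ?(gt_eqF (pi_gt0 R)) //.
  by rewrite subr_eq0 eqr_nat.
apply: (mulfI (_ : expi (2 * a) - 1 != 0)); first by rewrite subr_eq0.
rewrite -subrX1 mulr0 -expi_nat.
have -> : 2 * a * p%:R = 2 * pi * (i%:Z - j%:Z)%:~R.
  by rewrite rmorphB /= /a -!pmulrn; field; rewrite gt_eqF.
by rewrite expi_2piz subrr.
Qed.

Definition dft z : 'M[C]_(m, n) :=
  \matrix_(u < m, v < n) \sum_(i < m) \sum_(j < n)
    z i j * expi (- (2 * pi * (u%:R * i%:R / m%:R + v%:R * j%:R / n%:R))).

Definition idft z : 'M[C]_(m, n) :=
  \matrix_(i < m, j < n) ((m * n)%:R^-1 * \sum_(u < m) \sum_(v < n)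
    z u v * expi (2 * pi * (u%:R * i%:R / m%:R + v%:R * j%:R / n%:R))).

Definition quad_form (a b c s t : R) : R := a * s ^+ 2 + b * s * t + c * t ^+ 2.

Lemma dftK z : idft (dft z) = z.
Proof.
apply/matrixP => i j; rewrite mxE.
have m_gt0 : (0 < m)%N by case: (m) i => [[]|].
have n_gt0 : (0 < n)%N by case: (n) j => [[]|].
transitivity ((m * n)%:R^-1 * \sum_(i' < m) \sum_(j' < n)
    z i' j' * (((i == i') * m)%:R * ((j == j') * n)%:R)).
  congr (_ * _).
  transitivity (\sum_(u < m) \sum_(v < n) \sum_(i' < m) \sum_(j' < n)
    z i' j' * (expi (2 * pi * (u%:R * i%:R / m%:R - u%:R * i'%:R / m%:R))
             * expi (2 * pi * (v%:R * j%:R / n%:R - v%:R * j'%:R / n%:R)))).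
    apply: eq_bigr => u _; apply: eq_bigr => v _; rewrite mxE mulr_suml.
    apply: eq_bigr => i' _; rewrite mulr_suml; apply: eq_bigr => j' _.
    by rewrite -mulrA -!expiD; congr (_ * expi _); ring.
  under eq_bigr do rewrite exchange_big.
  rewrite exchange_big; apply: eq_bigr => i' _ /=.
  under eq_bigr do rewrite exchange_big.
  rewrite exchange_big; apply: eq_bigr => j' _ /=.
  rewrite -!sum_expi mulr_suml mulr_sumr; apply: eq_bigr => u _.
  by rewrite !mulr_sumr.
rewrite (bigD1 i) //= (bigD1 j) //= !eqxx !mul1n -natrM.
rewrite !big1 ?addr0 => [|i' /negPf ni|j' /negPf nj].
- by rewrite mulrCA mulVf ?mulr1 // pnatr_eq0 -lt0n muln_gt0 m_gt0.
- by rewrite big1 // => j' _; rewrite eq_sym ni mul0n mul0r mulr0.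
- by rewrite [j == j']eq_sym nj mul0n !mulr0.
Qed.

Lemma idftK z : dft (idft z) = z.
Proof.
apply/matrixP => i j; rewrite mxE.
have m_gt0 : (0 < m)%N by case: (m) i => [[]|].
have n_gt0 : (0 < n)%N by case: (n) j => [[]|].
transitivity ((m * n)%:R^-1 * \sum_(i' < m) \sum_(j' < n)
    z i' j' * (((i' == i) * m)%:R * ((j' == j) * n)%:R)).
  transitivity ((m * n)%:R^-1 *
    \sum_(u < m) \sum_(v < n) \sum_(i' < m) \sum_(j' < n)
    z i' j' * (expi (2 * pi * (u%:R * i'%:R / m%:R - u%:R * i%:R / m%:R))
             * expi (2 * pi * (v%:R * j'%:R / n%:R - v%:R * j%:R / n%:R)))).
    rewrite mulr_sumr; apply: eq_bigr => u _; rewrite mulr_sumr.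
    apply: eq_bigr => v _; rewrite mxE -[LHS]mulrA mulr_suml; congr (_ * _).
    apply: eq_bigr => i' _; rewrite mulr_suml; apply: eq_bigr => j' _.
    by rewrite -mulrA -!expiD; congr (_ * expi _); ring.
  congr (_ * _).
  under eq_bigr do rewrite exchange_big.
  rewrite exchange_big; apply: eq_bigr => i' _ /=.
  under eq_bigr do rewrite exchange_big.
  rewrite exchange_big; apply: eq_bigr => j' _ /=.
  rewrite -!sum_expi mulr_suml mulr_sumr; apply: eq_bigr => u _.
  by rewrite !mulr_sumr.
rewrite (bigD1 i) //= (bigD1 j) //= !eqxx !mul1n -natrM.
rewrite !big1 ?addr0 => [|i' /negPf ni|j' /negPf nj].
- by rewrite mulrCA mulVf ?mulr1 // pnatr_eq0 -lt0n muln_gt0 m_gt0.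
- by rewrite big1 // => j' _; rewrite ni mul0n mul0r mulr0.
- by rewrite nj mul0n !mulr0.
Qed.

(* For even m and n, so that m./2 and n./2 are m/2 and n/2. *)
Definition centrosymmetric_gaussian (y : 'M[R]_(m, n)) : Prop :=
  (exists A a b c : R,
     [/\ 0 < A,
         forall s t : R, (s, t) != (0, 0) -> 0 < quad_form a b c s t
       & forall i j : int,
           - (m./2)%:Z <= i < (m./2)%:Z -> - (n./2)%:Z <= j < (n./2)%:Z ->
           entry y i j = A * expR (- quad_form a b c i%:~R j%:~R)]) /\
  (forall i j : int, entry y i j = entry y (- i) (- j)).

End Arrays.

(* The regularized linear least-squares problem
     min_f  \sum_k alpha_k ||A_k f - b||^2 + lambda ||f||^2
   through its normal equations. *)
Section LeastSquares.
Variables (R : realType) (t p q : nat).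
Local Notation C := R[i].
Variables (alpha : 'I_t -> R) (lambda : R).
Variables (A : 'I_t -> 'M[C]_(p, q)) (b : 'cV[C]_p).

Definition lsq_mx : 'M[C]_q :=
  \sum_(k < t) (alpha k)%:C *: ((A k)^t* *m A k) + (lambda%:C)%:M.

Definition lsq_solvable : Prop := lsq_mx \in unitmx.

Definition lsq_solution : 'cV[C]_q :=
  invmx lsq_mx *m \sum_(k < t) (alpha k)%:C *: ((A k)^t* *m b).

End LeastSquares.

(* C^{mn} is 'cV[C]_(m * n), vectorized in the order of mxvec; C^{d mn} is
   'cV[C]_(\sum_(l < d) m * n), the type of block columns \mxcol_(l < d). *)
Section Filters.
Variables (R : realType) (m n d t : nat).
Local Notation C := R[i].
Local Notation N := (m * n)%N.
Variables (alpha : 'I_t -> R) (lambda : R).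
Variables (x : 'I_t -> 'I_d -> 'M[R]_(m, n)) (y : 'M[R]_(m, n)).

Definition diag_hat (z : 'M[R]_(m, n)) : 'M[C]_N := diag_mx (mxvec (dft (toC z))).

Definition y_hat : 'cV[C]_N := (mxvec (dft (toC y)))^T.

Definition X_corr (k : 'I_t) : 'M[C]_(N, \sum_(l < d) N) :=
  \mxrow_(l < d) (diag_hat (x k l))^t*.

Definition X_conv (k : 'I_t) : 'M[C]_(N, \sum_(l < d) N) :=
  \mxrow_(l < d) diag_hat (x k l).

Definition corr_solution_exists : Prop := lsq_solvable alpha lambda X_corr.
Definition conv_solution_exists : Prop := lsq_solvable alpha lambda X_conv.

Definition corr_solution : 'cV[C]_(\sum_(l < d) N) :=
  lsq_solution alpha lambda X_corr y_hat.
Definition conv_solution : 'cV[C]_(\sum_(l < d) N) :=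
  lsq_solution alpha lambda X_conv y_hat.

Definition spatial_filter (f : 'cV[C]_(\sum_(l < d) N)) (l : 'I_d) : 'M[C]_(m, n) :=
  idft (vec_mx (submxcol f l)^T).

Definition corr_response (x' : 'I_d -> 'M[R]_(m, n)) (f : 'I_d -> 'M[C]_(m, n)) :=
  \sum_(l < d) circ_corr (toC (x' l)) (f l).
Definition conv_response (x' : 'I_d -> 'M[R]_(m, n)) (f : 'I_d -> 'M[C]_(m, n)) :=
  \sum_(l < d) circ_conv (toC (x' l)) (f l).

End Filters.

(* Main.v *)
(* Let J be the point reflection (i, j) |-> (-i, -j) of periodic arrays.  Since
   diag(x^)^H = conj(diag(x^)), the corr design matrices are the conjugates of
   the conv ones, hence so are the normal equations; as y is real and even, y^ is
   real, so the solutions are conjugate.  Since x is real, conj(x^) = J x^, so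
   conjugating the conv design matrices amounts to multiplying them on both sides
   by permutation matrices; by uniqueness conj(f'^) = J f'^, i.e. the spatial conv
   filter f' is real.  Hence f = J (conj f') = J f', and correlation of a real x
   with J f' is J applied to the convolution of x with f'. *)
Require Import Defs.
From HB Require Import structures.
From mathcomp Require Import all_boot all_order all_algebra.
From mathcomp Require Import complex reals.
From mathcomp Require Import perm trigo ring zify.

Set Implicit Arguments.
Unset Strict Implicit.
Unset Printing Implicit Defensive.

Import Order.TTheory GRing.Theory Num.Theory.
Local Open Scope ring_scope.
Local Open Scope sesquilinear_scope.

(** * Entrywise maps and products of block matrices *)

Lemma map_mxrow (S T : Type) (f : S -> T) (p m : nat) (p_ : 'I_p -> nat)
    (B : forall l, 'M[S]_(m, p_ l)) :
  map_mx f (\mxrow_l B l) = \mxrow_l map_mx f (B l).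
Proof. by apply/matrixP => i j; rewrite !mxE. Qed.

Lemma map_mxdiag (S T : nmodType) (f : {additive S -> T}) (p : nat)
    (p_ : 'I_p -> nat) (B : forall l, 'M[S]_(p_ l)) :
  map_mx f (\mxdiag_l B l) = \mxdiag_l map_mx f (B l).
Proof.
rewrite /mxdiag (_ : map_mx f _ = \mxblock_(i, j) map_mx f
  (if i == j then conform_mx 0 (B i) else 0)); last first.
  by apply/matrixP => i j; rewrite !mxE.
apply/eq_mxblock => i j.
by case: eqVneq => [->|_]; rewrite ?conform_mx_id ?map_mx0.
Qed.

Lemma mul_mxdiag (R : pzSemiRingType) (p : nat) (p_ : 'I_p -> nat)
    (A B : forall l, 'M[R]_(p_ l)) :
  \mxdiag_l A l *m \mxdiag_l B l = \mxdiag_l (A l *m B l).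
Proof.
rewrite [in LHS]/mxdiag mul_mxblock_mxdiag; apply/eq_mxblock => i j.
by case: eqVneq => [->|_]; rewrite ?conform_mx_id ?mul0mx.
Qed.

Lemma conj_realC (R : realType) (a : R) : Num.conj (a%:C)%C = (a%:C)%C :> R[i].
Proof. exact: conjc_real. Qed.

(** * Behaviour of regularized least squares under conjugation and unitary changes of basis *)

Section LeastSquaresSymmetries.
Variables (R : realType) (t p q : nat) (alpha : 'I_t -> R) (lambda : R).
Local Notation C := R[i].
Implicit Types (A B : 'I_t -> 'M[C]_(p, q)) (b : 'cV[C]_p).

Lemma eq_lsq_mx A B : A =1 B -> lsq_mx alpha lambda A = lsq_mx alpha lambda B.
Proof. by move=> AB; congr (_ + _); apply: eq_bigr => k _; rewrite AB. Qed.

Lemma eq_lsq_solution A B b : A =1 B ->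
  lsq_solution alpha lambda A b = lsq_solution alpha lambda B b.
Proof.
move=> AB; rewrite /lsq_solution (eq_lsq_mx AB); congr (_ *m _).
by apply: eq_bigr => k _; rewrite AB.
Qed.

(** Conjugation is a ring automorphism that commutes with the adjoint and fixes the real weights
    [alpha] and [lambda]. *)
Lemma lsq_mx_conj A :
  lsq_mx alpha lambda (fun k => map_mx Num.conj (A k)) =
  map_mx Num.conj (lsq_mx alpha lambda A).
Proof.
rewrite /lsq_mx map_mxD map_mx_sum map_scalar_mx /= conj_realC; congr (_ + _).
apply: eq_bigr => k _.
by rewrite map_mxZ map_mxM -!map_trmx /= conj_realC.
Qed.

Lemma lsq_solution_conj A b :
  lsq_solution alpha lambda (fun k => map_mx Num.conj (A k)) (map_mx Num.conj b)
  = map_mx Num.conj (lsq_solution alpha lambda A b).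
Proof.
rewrite /lsq_solution lsq_mx_conj map_mxM map_invmx map_mx_sum.
congr (_ *m _); apply: eq_bigr => k _.
by rewrite map_mxZ map_mxM -!map_trmx /= conj_realC.
Qed.

Section Unitary.
Variables (P : 'M[C]_p) (Q : 'M[C]_q).
Hypotheses (P_unitary : P^t* *m P = 1%:M) (Q_unitary : Q^t* *m Q = 1%:M).

(** [P] cancels inside each Gram matrix, and the ridge term survives because [Q^t* *m Q] is the
    identity. *)
Lemma lsq_mx_unitary A :
  lsq_mx alpha lambda (fun k => P *m A k *m Q) =
  Q^t* *m lsq_mx alpha lambda A *m Q.
Proof.
rewrite /lsq_mx mulmxDr mulmxDl; congr (_ + _); last first.
  by rewrite mul_mx_scalar -scalemxAl Q_unitary scalemx1.
rewrite mulmx_sumr mulmx_suml; apply: eq_bigr => k _.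
rewrite -scalemxAr -scalemxAl; congr (_ *: _).
rewrite !trmx_mul !map_mxM !mulmxA.
by rewrite -[_ *m P^t* *m P]mulmxA P_unitary mulmx1.
Qed.

(** The isometry [P] does not change the residual norms, and the substitution [f = Q *m g] preserves
    the penalty; hence the minimizers correspond by [g = Q^t* *m f]. *)
Lemma lsq_solution_unitary A b : lsq_solvable alpha lambda A ->
  lsq_solution alpha lambda (fun k => P *m A k *m Q) (P *m b) =
  Q^t* *m lsq_solution alpha lambda A b.
Proof.
move=> A_unit; have QQ' := mulmx1C Q_unitary.
have /andP[Q'_unit Q_unit] : (Q^t* \in unitmx) && (Q \in unitmx).
  by apply/andP; exact: mulmx1_unit Q_unitary.
rewrite /lsq_solution lsq_mx_unitary.
set M := lsq_mx _ _ A; have M_unit : M \in unitmx by [].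
(* Multiplying by the invertible system matrix leaves only the normal equations to check. *)
apply: (can_inj (mulKmx (_ : Q^t* *m M *m Q \in unitmx))).
  by rewrite !unitmx_mul Q'_unit M_unit.
rewrite mulKVmx ?unitmx_mul ?Q'_unit ?M_unit //.
rewrite -!mulmxA (mulmxA Q) QQ' mul1mx mulKVmx // mulmx_sumr.
apply: eq_bigr => k _; rewrite -scalemxAr; congr (_ *: _).
by rewrite !trmx_mul !map_mxM !mulmxA -[_ *m P^t* *m P]mulmxA P_unitary mulmx1.
Qed.

End Unitary.
End LeastSquaresSymmetries.

(** * Point reflection of periodic arrays *)

Lemma opp_ord_subproof (m : nat) (i : 'I_m) : ((m - i) %% m < m)%N.
Proof. by rewrite ltn_pmod //; case: m i => [[]|]. Qed.

Definition opp_ord (m : nat) (i : 'I_m) : 'I_m := Ordinal (opp_ord_subproof i).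

(** The multiple of [m] separating [opp_ord i] from [- i] is kept explicit so that periodicity can
    absorb it; it vanishes only at [i = 0], which is its own reflection. *)
Lemma opp_ordE (m : nat) (i : 'I_m) :
  (opp_ord i)%:Z = - i%:Z + (i != 0%N :> nat)%:Z * m%:Z.
Proof.
rewrite /=; case: eqP => [->|/eqP i0] /=; first by rewrite subn0 modnn.
by rewrite modn_small; have := ltn_ord i; lia.
Qed.

Lemma opp_ordK (m : nat) : involutive (@opp_ord m).
Proof.
move=> i; apply: val_inj => /=; have lt_im := ltn_ord i.
have [->|i_gt0] := posnP i; first by rewrite subn0 modnn subn0 modnn.
have lt_mi : (m - i < m)%N by lia.
by rewrite (modn_small lt_mi) subKn ?modn_small // ltnW.
Qed.

Lemma int_ordP (m : nat) (i : int) : (0 < m)%N ->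
  exists (p : 'I_m) (a : int), i = p%:Z + a * m%:Z.
Proof.
move=> m_gt0; have m0 : m%:Z != 0 by lia.
have lt_m : (`|(i %% m)%Z| < m)%N.
  by have := modz_ge0 i m0; have := ltz_pmod i (_ : 0 < m%:Z); lia.
exists (Ordinal lt_m), (i %/ m)%Z => /=.
by rewrite gez0_abs ?modz_ge0 // addrC -divz_eq.
Qed.

Section PointReflection.
Variables (V : nmodType) (m n : nat).
Implicit Type z : 'M[V]_(m, n).

Definition reflect_mx z : 'M[V]_(m, n) := \matrix_(i, j) z (opp_ord i) (opp_ord j).

Lemma reflect_mxK : involutive reflect_mx.
Proof. by move=> z; apply/matrixP => i j; rewrite !mxE !opp_ordK. Qed.

Lemma entry_opp_ord z (i : 'I_m) (j : 'I_n) (a b : int) :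
  entry z ((opp_ord i)%:Z + a) ((opp_ord j)%:Z + b) =
  entry z (- i%:Z + a) (- j%:Z + b).
Proof. by rewrite !opp_ordE ![_ + _ * _ + _]addrAC entry_modz. Qed.

Hypotheses (m_gt0 : (0 < m)%N) (n_gt0 : (0 < n)%N).

Lemma entry_reflect z (i j : int) : entry (reflect_mx z) i j = entry z (- i) (- j).
Proof.
have [p [a ->]] := int_ordP i m_gt0; have [q [b ->]] := int_ordP j n_gt0.
rewrite entry_modz entry_ord mxE -entry_ord !opprD -!mulNr entry_modz.
by have := entry_opp_ord z p q 0 0; rewrite !addr0.
Qed.

Lemma even_reflect z :
  (forall i j, entry z i j = entry z (- i) (- j)) -> reflect_mx z = z.
Proof.
by move=> ez; apply/matrixP => i j; rewrite -!entry_ord entry_reflect -ez.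
Qed.

End PointReflection.

Lemma map_reflect_mx (V W : nmodType) (f : V -> W) (m n : nat) (z : 'M[V]_(m, n)) :
  map_mx f (reflect_mx z) = reflect_mx (map_mx f z).
Proof. by apply/matrixP => i j; rewrite !mxE. Qed.

(** * The Fourier transform, convolution and correlation under reflection *)

Section Fourier.
Variables (R : realType) (m n : nat).
Local Notation C := R[i].
Implicit Types (z x f : 'M[C]_(m, n)).

Lemma conj_expi (a : R) : Num.conj (expi a) = expi (- a).
Proof. by rewrite /expi cosN sinN. Qed.

Lemma expi_opp_ord (u i : 'I_m) (v j : 'I_n) :
  expi (2 * pi * (u%:R * (opp_ord i)%:R / m%:R + v%:R * (opp_ord j)%:R / n%:R)) =
  expi (- (2 * pi * (u%:R * i%:R / m%:R + v%:R * j%:R / n%:R))) :> C.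
Proof.
have ordR k (w : 'I_k) : (opp_ord w)%:R =
    - w%:R + ((w != 0%N :> nat) : nat)%:R * k%:R :> R.
  by have /(congr1 (intr : int -> R)) := opp_ordE w; rewrite rmorphD rmorphN rmorphM.
have [m0 n0] : m%:R != 0 :> R /\ n%:R != 0 :> R.
  by rewrite !pnatr_eq0; split; [case: m u => [[]|] | case: n v => [[]|]].
rewrite !ordR; set a : nat := _ != _; set b : nat := _ != _.
(* The frequencies are integers, so wrapping the positions around shifts the phase by an integer
   multiple of [2 * pi]. *)
have -> : 2 * pi * (u%:R * (- i%:R + a%:R * m%:R) / m%:R +
                    v%:R * (- j%:R + b%:R * n%:R) / n%:R) =
  - (2 * pi * (u%:R * i%:R / m%:R + v%:R * j%:R / n%:R)) +
  2 * pi * (u * a + v * b)%N%:Z%:~R :> R.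
  by rewrite -pmulrn natrD !natrM; field; rewrite m0 n0.
by rewrite expiD expi_2piz mulr1.
Qed.

(** Conjugating the kernel flips the sign of its phase, which is the same as negating the
    frequency. *)
Lemma dft_conj z : dft (map_mx Num.conj z) = reflect_mx (map_mx Num.conj (dft z)).
Proof.
apply/matrixP => u v; rewrite !mxE rmorph_sum; apply: eq_bigr => i _.
rewrite rmorph_sum; apply: eq_bigr => j _; rewrite !mxE rmorphM /= conj_expi opprK.
(* The phase is symmetric in frequency and position: after commuting the products, [expi_opp_ord]
   acts on frequencies. *)
congr (_ * _); rewrite ![(opp_ord _)%:R * _]mulrC expi_opp_ord.
by rewrite ![_%:R * u%:R]mulrC ![_%:R * v%:R]mulrC.
Qed.

Lemma dft_reflect z : dft (reflect_mx z) = reflect_mx (dft z).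
Proof.
apply/matrixP => u v; rewrite !mxE.
rewrite (reindex_inj (can_inj (@opp_ordK m))); apply: eq_bigr => i _.
rewrite (reindex_inj (can_inj (@opp_ordK n))); apply: eq_bigr => j _.
rewrite mxE !opp_ordK; congr (_ * _).
rewrite ![(opp_ord u)%:R * _]mulrC ![(opp_ord v)%:R * _]mulrC.
by rewrite -!conj_expi !expi_opp_ord ![_%:R * u%:R]mulrC ![_%:R * v%:R]mulrC.
Qed.

Lemma idft_conj z : idft (map_mx Num.conj z) = reflect_mx (map_mx Num.conj (idft z)).
Proof.
by apply: (can_inj (@dftK R m n));
  rewrite idftK dft_reflect dft_conj reflect_mxK idftK.
Qed.

Lemma conj_toC (z : 'M[R]_(m, n)) : map_mx Num.conj (toC z) = toC z.
Proof. by apply/matrixP => i j; rewrite !mxE conj_realC. Qed.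

Lemma dft_toC_conj (z : 'M[R]_(m, n)) :
  map_mx Num.conj (dft (toC z)) = reflect_mx (dft (toC z)).
Proof. by rewrite -{2}conj_toC dft_conj reflect_mxK. Qed.

(** Realness of [x] removes the conjugate, and reading [f] at [-(p + i)] is the convolution index at
    the reflected point [-i]. *)
Lemma circ_corr_reflect (x : 'M[R]_(m, n)) f :
  circ_corr (toC x) (reflect_mx f) = reflect_mx (circ_conv (toC x) f).
Proof.
apply/matrixP => i j; rewrite !mxE; apply: eq_bigr => p _; apply: eq_bigr => q _.
have [m_gt0 n_gt0] : (0 < m)%N /\ (0 < n)%N.
  by split; [case: m i => [[]|] | case: n j => [[]|]].
rewrite entry_reflect // entry_opp_ord !mxE conj_realC.
by rewrite !opprD ![- p%:Z + _]addrC ![- q%:Z + _]addrC.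
Qed.

Lemma frobenius_reflect z : frobenius (reflect_mx z) = frobenius z.
Proof.
rewrite /frobenius; congr Num.sqrt.
rewrite (reindex_inj (can_inj (@opp_ordK m))); apply: eq_bigr => i _.
rewrite (reindex_inj (can_inj (@opp_ordK n))); apply: eq_bigr => j _.
by rewrite mxE !opp_ordK.
Qed.

(** * Reflection of vectorized arrays as a permutation matrix *)

Definition reflect_index (k : 'I_(m * n)) : 'I_(m * n) :=
  let ij := enum_val (cast_ord (esym (mxvec_cast m n)) k) in
  mxvec_index (opp_ord ij.1) (opp_ord ij.2).

Lemma reflect_indexE (i : 'I_m) (j : 'I_n) :
  reflect_index (mxvec_index i j) = mxvec_index (opp_ord i) (opp_ord j).
Proof. by rewrite /reflect_index /mxvec_index cast_ordK enum_rankK. Qed.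

Lemma reflect_indexK : involutive reflect_index.
Proof. by move=> k; case/mxvec_indexP: k => i j; rewrite !reflect_indexE !opp_ordK. Qed.

Definition reflect_perm : 'S_(m * n) := perm (can_inj reflect_indexK).

Definition vec_reflect_mx : 'M[C]_(m * n) := perm_mx reflect_perm.

Lemma vec_reflect_mxK : vec_reflect_mx *m vec_reflect_mx = 1%:M.
Proof.
rewrite -perm_mxM (_ : (_ * _)%g = 1%g) ?perm_mx1 //.
by apply/permP => k; rewrite permM !permE reflect_indexK.
Qed.

Lemma vec_reflect_mx_adj : vec_reflect_mx^t* = vec_reflect_mx.
Proof.
rewrite tr_perm_mx map_perm_mx; congr perm_mx; apply/permP => k.
by apply: (@perm_inj _ reflect_perm); rewrite permKV !permE reflect_indexK.
Qed.

Lemma mul_vec_reflect_mx z :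
  vec_reflect_mx *m (mxvec z)^T = (mxvec (reflect_mx z))^T.
Proof.
rewrite -row_permE; apply/matrixP => k l; rewrite !mxE ord1 permE.
by case/mxvec_indexP: k => i j; rewrite reflect_indexE !mxvecE mxE.
Qed.

(** Permuting the diagonal entries is conjugation by the permutation matrix, which is its own
    inverse. *)
Lemma diag_reflect_mx z :
  diag_mx (mxvec (reflect_mx z)) =
  vec_reflect_mx *m diag_mx (mxvec z) *m vec_reflect_mx.
Proof.
suff e : vec_reflect_mx *m diag_mx (mxvec z) =
    diag_mx (mxvec (reflect_mx z)) *m vec_reflect_mx.
  by rewrite e -mulmxA vec_reflect_mxK mulmx1.
rewrite -row_permE mul_diag_mx; apply/matrixP => k l; rewrite !mxE permE.
rewrite -mulr_natr; congr (_ * _).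
by case/mxvec_indexP: k => i j; rewrite reflect_indexE !mxvecE mxE.
Qed.

End Fourier.

(** * Comparison of the correlation and convolution filters *)

Section Filters.
Variables (R : realType) (m n d t : nat).
Local Notation C := R[i].
Variables (alpha : 'I_t -> R) (lambda : R).
Variables (x : 'I_t -> 'I_d -> 'M[R]_(m, n)) (y : 'M[R]_(m, n)).

Let Q : 'M[C]_(\sum_(l < d) m * n) := \mxdiag_(l < d) vec_reflect_mx R m n.

Lemma X_corr_conj k : X_corr x k = map_mx Num.conj (X_conv x k).
Proof.
rewrite /X_corr /X_conv map_mxrow; apply/eq_mxrowP => l.
by rewrite /diag_hat tr_diag_mx.
Qed.

(** One left factor serves all blocks, while the right factors, one per channel, assemble into the
    block diagonal [Q]. *)
Lemma X_conv_conj k :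
  map_mx Num.conj (X_conv x k) = vec_reflect_mx R m n *m X_conv x k *m Q.
Proof.
rewrite /X_conv map_mxrow mul_mxrow mul_mxrow_mxdiag; apply/eq_mxrowP => l.
by rewrite /diag_hat map_diag_mx map_mxvec dft_toC_conj diag_reflect_mx.
Qed.

Lemma y_hat_conj : map_mx Num.conj (y_hat y) = vec_reflect_mx R m n *m y_hat y.
Proof. by rewrite /y_hat mul_vec_reflect_mx -dft_toC_conj -map_trmx map_mxvec. Qed.

Lemma corr_existsE :
  corr_solution_exists alpha lambda x <-> conv_solution_exists alpha lambda x.
Proof.
rewrite /corr_solution_exists /conv_solution_exists /lsq_solvable.
by rewrite (eq_lsq_mx _ _ X_corr_conj) lsq_mx_conj map_unitmx.
Qed.

Lemma corr_solution_conj : reflect_mx y = y ->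
  corr_solution alpha lambda x y = map_mx Num.conj (conv_solution alpha lambda x y).
Proof.
move=> ey; rewrite /corr_solution (eq_lsq_solution _ _ _ X_corr_conj).
(* The system matrices now agree; what remains is that [y_hat y] is real, which follows from the
   evenness of [y]. *)
rewrite -lsq_solution_conj y_hat_conj mul_vec_reflect_mx -dft_reflect.
by rewrite /toC -map_reflect_mx ey.
Qed.

(** Conjugating the data is a unitary change of basis by reflections, for any real [y], even or
    not. *)
Lemma conv_solution_conj : conv_solution_exists alpha lambda x ->
  map_mx Num.conj (conv_solution alpha lambda x y) =
  Q *m conv_solution alpha lambda x y.
Proof.
move=> ex.
have Q_adj : Q^t* = Q.
  by rewrite tr_mxdiag map_mxdiag; apply/eq_mxdiagP => l; rewrite vec_reflect_mx_adj.
have QQ : Q *m Q = 1%:M.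
  by rewrite mul_mxdiag -mxdiagZ; apply/eq_mxdiagP => l; rewrite vec_reflect_mxK.
rewrite -lsq_solution_conj (eq_lsq_solution _ _ _ X_conv_conj) y_hat_conj.
by rewrite lsq_solution_unitary ?Q_adj // vec_reflect_mx_adj vec_reflect_mxK.
Qed.

Lemma spatial_filter_conj (f : 'cV[C]_(\sum_(l < d) m * n)) l :
  spatial_filter (map_mx Num.conj f) l =
  reflect_mx (map_mx Num.conj (spatial_filter f l)).
Proof.
rewrite /spatial_filter -idft_conj; congr idft.
by apply/matrixP => i j; rewrite !mxE.
Qed.

Lemma conv_filter_real l : conv_solution_exists alpha lambda x ->
  map_mx Num.conj (spatial_filter (conv_solution alpha lambda x y) l) =
  spatial_filter (conv_solution alpha lambda x y) l.
Proof.
move=> ex; set f := conv_solution _ _ _ _.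
(* Reflecting both sides turns the conjugate filter into the filter of the conjugate spectrum; the
   claim is then the reflection symmetry of the spectrum, block by block. *)
apply: (can_inj (@reflect_mxK _ m n)); rewrite -spatial_filter_conj.
rewrite (conv_solution_conj ex) -/f /spatial_filter.
apply: (can_inj (@dftK R m n)); rewrite dft_reflect !idftK.
apply: (can_inj (@mxvecK _ m n)); apply: trmx_inj.
rewrite -mul_vec_reflect_mx !vec_mxK !trmxK.
by rewrite -{1}(submxcolK f) /Q mul_mxdiag_mxcol mxcolK.
Qed.

Lemma corr_response_reflect (x' : 'I_d -> 'M[R]_(m, n))
    (f : 'I_d -> 'M[C]_(m, n)) :
  corr_response x' (fun l => reflect_mx (f l)) = reflect_mx (conv_response x' f).
Proof.
apply/matrixP => i j; rewrite mxE !summxE; apply: eq_bigr => l _.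
by rewrite circ_corr_reflect mxE.
Qed.

End Filters.

Theorem proposition1 (R : realType) (m n d t : nat)
    (m_gt0 : (0 < m)%N) (n_gt0 : (0 < n)%N)
    (m_even : ~~ odd m) (n_even : ~~ odd n)
    (d_gt0 : (0 < d)%N) (t_gt0 : (0 < t)%N)
    (x : 'I_t -> 'I_d -> 'M[R]_(m, n))
    (alpha : 'I_t -> R) (alpha_ge0 : forall k, 0 <= alpha k)
    (lambda : R) (lambda_ge0 : 0 <= lambda)
    (y : 'M[R]_(m, n)) :
  (corr_solution_exists alpha lambda x <-> conv_solution_exists alpha lambda x)
  /\
  (corr_solution_exists alpha lambda x -> conv_solution_exists alpha lambda x ->
   centrosymmetric_gaussian y ->
   let fhat  := corr_solution alpha lambda x y in
   let fhat' := conv_solution alpha lambda x y in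
   fhat = map_mx Num.conj fhat' /\
   forall x' : 'I_d -> 'M[R]_(m, n),
     let r  := corr_response x' (spatial_filter fhat) in
     let r' := conv_response x' (spatial_filter fhat') in
     frobenius (r - toC y) ^+ 2 = frobenius (r' - toC y) ^+ 2 /\
     forall i j : int,
       - (m./2)%:Z <= i <= (m./2)%:Z -> - (n./2)%:Z <= j <= (n./2)%:Z ->
       entry r i j = entry r' (- i) (- j)).
Proof.
split=> [|_ conv_ex [_ y_even]]; first exact: corr_existsE.
have ey : reflect_mx y = y by exact: even_reflect.
move=> fhat fhat'; have fhatE : fhat = map_mx Num.conj fhat'.
  exact: corr_solution_conj.
split; first exact: fhatE.
move=> x' r r'.
have rE : r = reflect_mx r'.
  rewrite /r /r' -corr_response_reflect; apply: eq_bigr => l _.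
  (* Conjugating the spectrum reflects and conjugates the spatial filter; the second operation is
     invisible on the real convolution filter. *)
  by rewrite fhatE spatial_filter_conj conv_filter_real.
move: r r' rE => r r' rE.
split=> [|i j _ _]; last by rewrite rE entry_reflect.
(* As [y] equals its reflection, the two residuals are reflections of each other. *)
suff -> : r - toC y = reflect_mx (r' - toC y) by rewrite frobenius_reflect.
by rewrite rE -{1}ey; apply/matrixP => i j; rewrite !mxE.
Qed.
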